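(* Let $2\le m\le n$ and let $n_1,\dots,n_m\geq 1$ be integers with $n=n_1+n_2+\dots+n_m$. Denote by $\mathbf{B}^k$ the Euclidean unit ball in $\mathbf{C}^k$. There is no $C^1$-Kobayashi isometry and no $C^1$-Carathéodory isometry between $\mathbf{B}^n$ and the product $\mathbf{B}^{n_1}\times\mathbf{B}^{n_2}\times\dots\times\mathbf{B}^{n_m}$.
   Context: $\Delta$ is the open unit disc in $\mathbf{C}$. For a domain $D\subset\mathbf{C}^n$, $z\in D$ and $\xi\in\mathbf{C}^n$, the infinitesimal Kobayashi and Carathéodory metrics are $$F^K_D(z,\xi)=\inf\{1/\alpha:\alpha>0,\ \exists f:\Delta\to D\text{ holomorphic},\ f(0)=z,\ f'(0)=\alpha\xi\},$$ $$F^C_D(z,\xi)=\sup\{|df(z)\xi|: f:D\to\Delta\text{ holomorphic}\}.$$ A $C^1$-Kobayashi isometry between domains $D_1,D_2$ is a $C^1$-diffeomorphism $f$ from $D_1$ onto $D_2$ (not assumed holomorphic) with $f^*(F^K_{D_2})=F^K_{D_1}$, i.e. $F^K_{D_2}(f(z),df(z)\xi)=F^K_{D_1}(z,\xi)$ for all $z\in D_1$ and all tangent vectors $\xi$ at $z$ (tangent vectors being identified with elements of $\mathbf{C}^n$ and $df(z)$ being the real differential). A $C^1$-Carathéodory isometry is defined in the same way with $F^C$ in place of $F^K$. *)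

(* Defs.v *)
(* MathComp-Analysis: C is R[i] for R : realType, C^n is 'rV[R[i]]_n. *)
From HB Require Import structures.
From mathcomp Require Import all_boot all_order all_algebra.
From mathcomp Require Import complex.
From mathcomp Require Import all_classical all_reals all_analysis.

Set Implicit Arguments.
Unset Strict Implicit.
Unset Printing Implicit Defensive.

Import Order.TTheory GRing.Theory Num.Theory numFieldNormedType.Exports.

Local Open Scope classical_set_scope.
Local Open Scope ring_scope.
Local Open Scope complex_scope.

(* R[i] with the topology of its modulus, as a normed space over itself; this
   also makes 'rV[R[i]]_n a normed space over R[i], so that `differentiable`
   on such spaces means complex (Frechet) differentiability. *)
HB.instance Definition _ (R : rcfType) := NormedModule.copy R[i] R[i]^o.

Definition unit_disc (R : realType) : set R[i] := [set w | `|w| < 1].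
Arguments unit_disc R _ : clear implicits.

Definition unit_ball (R : realType) (n : nat) : set 'rV[R[i]]_n :=
  [set z | \sum_(j < n) `|z 0 j| ^+ 2 < 1].
Arguments unit_ball R n _ : clear implicits.

(* `submxrow z j` is the j-th block, in C^(n_ j), of z in C^(\sum_j n_ j). *)
Definition product_of_balls (R : realType) (m : nat) (n_ : 'I_m -> nat) :
    set 'rV[R[i]]_(\sum_(j < m) n_ j) :=
  [set z | forall j : 'I_m, unit_ball R (n_ j) (submxrow z j)].
Arguments product_of_balls R {m} n_ _.

(* Functions are total; only their values on the open set D matter. *)
Definition holomorphic_on (R : realType) (V W : normedModType R[i])
    (D : set V) (f : V -> W) : Prop :=
  forall z, D z -> differentiable f z.

(* For D open and z in D, both metrics take finite values. *)
Definition kobayashi_metric (R : realType) (n : nat)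
    (D : set 'rV[R[i]]_n) (z xi : 'rV[R[i]]_n) : \bar R :=
  ereal_inf [set (a^-1)%:E | a in [set a : R | 0 < a /\
    exists f : R[i] -> 'rV[R[i]]_n,
      [/\ holomorphic_on (unit_disc R) f,
          forall w, unit_disc R w -> D (f w),
          f 0 = z
        & (f^`())%classic 0 = a%:C *: xi]]].

Definition caratheodory_metric (R : realType) (n : nat)
    (D : set 'rV[R[i]]_n) (z xi : 'rV[R[i]]_n) : \bar R :=
  ereal_sup [set (complex.Re `|'d f z xi|)%:E | f in
    [set f : 'rV[R[i]]_n -> R[i] |
      holomorphic_on D f /\ forall w, D w -> unit_disc R (f w)]].

(* The identification of C^n with R^(2n), z = x + iy |-> (x, y), and its
   inverse; it carries real differentiability over to maps between complex
   spaces. *)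
Definition to_real (R : realType) (n : nat) (z : 'rV[R[i]]_n) : 'rV[R]_(n + n) :=
  row_mx (map_mx (@complex.Re R) z) (map_mx (@complex.Im R) z).

Definition of_real (R : realType) (n : nat) (x : 'rV[R]_(n + n)) : 'rV[R[i]]_n :=
  \row_j (lsubmx x 0 j +i* rsubmx x 0 j).

Definition realified (R : realType) (n p : nat)
    (f : 'rV[R[i]]_n -> 'rV[R[i]]_p) : 'rV[R]_(n + n) -> 'rV[R]_(p + p) :=
  @to_real R p \o f \o @of_real R n.

Definition real_diff (R : realType) (n p : nat)
    (f : 'rV[R[i]]_n -> 'rV[R[i]]_p) (z xi : 'rV[R[i]]_n) : 'rV[R[i]]_p :=
  of_real ('d (realified f) (to_real z) (to_real xi)).

Definition C1_on (R : realType) (n p : nat)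
    (D : set 'rV[R[i]]_n) (f : 'rV[R[i]]_n -> 'rV[R[i]]_p) : Prop :=
  forall z, D z ->
    differentiable (realified f) (to_real z) /\
    {for to_real z, continuous (jacobian (realified f))}.

Definition C1_diffeomorphism (R : realType) (n p : nat)
    (D1 : set 'rV[R[i]]_n) (D2 : set 'rV[R[i]]_p)
    (f : 'rV[R[i]]_n -> 'rV[R[i]]_p) : Prop :=
  [/\ set_bij D1 D2 f,
      C1_on D1 f
    & exists2 g : 'rV[R[i]]_p -> 'rV[R[i]]_n,
        forall z, D1 z -> g (f z) = z & C1_on D2 g].

Definition C1_isometry (R : realType)
    (F : forall k : nat,
      set 'rV[R[i]]_k -> 'rV[R[i]]_k -> 'rV[R[i]]_k -> \bar R)
    (n p : nat) (D1 : set 'rV[R[i]]_n) (D2 : set 'rV[R[i]]_p)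
    (f : 'rV[R[i]]_n -> 'rV[R[i]]_p) : Prop :=
  C1_diffeomorphism D1 D2 f /\
  forall z xi, D1 z -> F p D2 (f z) (real_diff f z xi) = F n D1 z xi.

Definition C1_kobayashi_isometry (R : realType) (n p : nat)
    (D1 : set 'rV[R[i]]_n) (D2 : set 'rV[R[i]]_p)
    (f : 'rV[R[i]]_n -> 'rV[R[i]]_p) : Prop :=
  C1_isometry (@kobayashi_metric R) D1 D2 f.

Definition C1_caratheodory_isometry (R : realType) (n p : nat)
    (D1 : set 'rV[R[i]]_n) (D2 : set 'rV[R[i]]_p)
    (f : 'rV[R[i]]_n -> 'rV[R[i]]_p) : Prop :=
  C1_isometry (@caratheodory_metric R) D1 D2 f.

(* Main.v *)
(* The metrics are compared at a single point. Schwarz's lemma gives [F^C <= F^K], so at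
   the centre of the ball linear functionals and linear discs pin both metrics down to
   the Euclidean norm. At a point of the product whose [j]-th block is [s_j e_j] with
   [e_j] a unit vector, put [a = (1 - s_0^2) e_0] and [b = (1 - s_1^2) e_1]: one-variable
   Mobius maps give [F^C(a), F^C(b) >= 1] and a disc moving in both blocks at once gives
   [F^K(a + b), F^K(a - b) <= 1]. The real differential of an isometry at the centre
   would transport this to vectors [u], [v] with [|u|, |v| >= 1] and
   [|u + v|, |u - v| <= 1], against the parallelogram law.

   Schwarz's lemma is needed for functions that are merely complex differentiable. It
   is obtained from Goursat's bisection applied to dyadic Riemann sums: they are exactly
   additive under bisection of a rectangle and vanish on affine closed forms, so no
   integral is needed. *)
From HB Require Import structures.
Require Import Defs.
From mathcomp Require Import all_boot all_order all_algebra.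
From mathcomp Require Import complex ring lra.
From mathcomp Require Import all_classical all_reals all_analysis.

Set Implicit Arguments.
Unset Strict Implicit.
Unset Printing Implicit Defensive.

Import Order.TTheory GRing.Theory Num.Theory numFieldNormedType.Exports.

Local Open Scope classical_set_scope.
Local Open Scope ring_scope.

(** * Goursat's bisection for Riemann sums *)

Section DyadicSums.
Context {R : realType}.
Implicit Types (f g : R -> R) (P Q : R -> R -> R) (a c w v e x y : R) (N : nat).

(** The left-endpoint Riemann sum on [2 ^ N] equal pieces of [[a, a + w]]. Recursion by halving
    makes additivity under bisection hold by computation. *)
Fixpoint dyadic_sum N f a w : R :=
  if N is N'.+1 then
    dyadic_sum N' f a (w / 2) + dyadic_sum N' f (a + w / 2) (w / 2)
  else w * f a.

Lemma dyadic_sumB N f g a w :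
  dyadic_sum N (fun s => f s - g s) a w = dyadic_sum N f a w - dyadic_sum N g a w.
Proof.
elim: N a w => [|N IH] a w /=; first by rewrite mulrBr.
by rewrite !IH; ring.
Qed.

Lemma dyadic_sum_close N f a w k e : 0 <= w ->
  (forall s, a <= s <= a + w -> `|f s - k| <= e) ->
  `|dyadic_sum N f a w - w * k| <= w * e.
Proof.
elim: N a w => [|N IH] a w w0 fk /=.
  by rewrite -mulrBr normrM ger0_norm// ler_wpM2l// fk// lexx lerDl.
have w20 : 0 <= w / 2 by lra.
have h1 := IH a _ w20 (fun s hs => fk s ltac:(lra)).
have h2 := IH (a + w / 2) _ w20 (fun s hs => fk s ltac:(lra)).
move: h1 h2; rewrite !ler_norml; lra.
Qed.

Lemma dyadic_sum_cst N k a w : dyadic_sum N (fun=> k) a w = w * k.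
Proof. by elim: N a w => [|N IH] a w //=; rewrite !IH; field. Qed.

Lemma dyadic_sum_mono N f g a w : 0 <= w -> (forall s, f s <= g s) ->
  dyadic_sum N f a w <= dyadic_sum N g a w.
Proof.
move=> + fg; elim: N a w => [|N IH] a w w0 /=; first by rewrite ler_wpM2l.
by apply: lerD; apply: IH; lra.
Qed.

(** The Riemann sum of [P ds + Q dt] counterclockwise around the rectangle with lower left corner
    [(a, c)] and sides [w], [v]. *)
Definition circulation N P Q a c w v : R :=
  dyadic_sum N (P^~ c) a w + dyadic_sum N (Q (a + w)) c v
  - dyadic_sum N (P^~ (c + v)) a w - dyadic_sum N (Q a) c v.

(** Inner edges are traversed once in each direction and cancel; outer half-edges concatenate
    exactly, since halving an edge uses up one level of refinement. *)
Lemma circulationS N P Q a c w v :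
  circulation N.+1 P Q a c w v =
    circulation N P Q a c (w / 2) (v / 2)
  + circulation N P Q (a + w / 2) c (w / 2) (v / 2)
  + circulation N P Q a (c + v / 2) (w / 2) (v / 2)
  + circulation N P Q (a + w / 2) (c + v / 2) (w / 2) (v / 2).
Proof.
rewrite /circulation /= -!addrA -!splitr.
ring.
Qed.

(* Frechet differentiability of [P ds + Q dt]; closedness is the shared coefficient [m]. *)
Definition closed_form_at P Q x y := exists l m p : R, forall e, 0 < e ->
  exists2 d, 0 < d & forall s t, `|s - x| <= d -> `|t - y| <= d ->
    `|P s t - P x y - l * (s - x) - m * (t - y)| <= e * (`|s - x| + `|t - y|) /\
    `|Q s t - Q x y - m * (s - x) - p * (t - y)| <= e * (`|s - x| + `|t - y|).

(** Pairing opposite sides, [P] changes by about [- m * v] and [Q] by about [m * w]; the shared [m]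
    makes the main terms cancel. Each difference costs the error [e / 2] twice, and [d] is uniform
    in [N]. *)
Lemma circulation_near P Q x y e : closed_form_at P Q x y -> 0 < e ->
  exists2 d, 0 < d & forall N a c w v, 0 <= w <= d -> 0 <= v <= d ->
    a <= x <= a + w -> c <= y <= c + v ->
    `|circulation N P Q a c w v| <= e * (w + v) ^+ 2.
Proof.
move=> [l [m [p cl]]] e0.
have [d d0 H] := cl (e / 2) ltac:(lra).
exists d => // N a c w v hw hv hx hy.
have bnd s t : a <= s <= a + w -> c <= t <= c + v ->
    `|s - x| <= w /\ `|t - y| <= v by rewrite !ler_norml; lra.
have {}H s t : a <= s <= a + w -> c <= t <= c + v ->
    `|P s t - P x y - l * (s - x) - m * (t - y)| <= e / 2 * (w + v) /\
    `|Q s t - Q x y - m * (s - x) - p * (t - y)| <= e / 2 * (w + v).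
  move=> hs ht; have [b1 b2] := bnd s t hs ht.
  have [|| h1 h2] := H s t; [lra..|].
  have le3 : e / 2 * (`|s - x| + `|t - y|) <= e / 2 * (w + v).
    by rewrite ler_wpM2l ?lerD//; lra.
  by split; [exact: le_trans h1 le3|exact: le_trans h2 le3].
have h1 : `|dyadic_sum N (fun s => P s c - P s (c + v)) a w - w * (- m * v)|
    <= w * (e * (w + v)).
  apply: dyadic_sum_close => [|s hs]; first lra.
  have [+ _] := H s c hs ltac:(lra); have [+ _] := H s (c + v) hs ltac:(lra).
  rewrite !ler_norml; lra.
have h2 : `|dyadic_sum N (fun t => Q (a + w) t - Q a t) c v - v * (m * w)|
    <= v * (e * (w + v)).
  apply: dyadic_sum_close => [|t ht]; first lra.
  have [_] := H a t ltac:(lra) ht; have [_] := H (a + w) t ltac:(lra) ht.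
  rewrite !ler_norml; lra.
move: h1 h2; rewrite !dyadic_sumB /circulation !ler_norml.
have -> : e * (w + v) ^+ 2 = w * (e * (w + v)) + v * (e * (w + v)) by ring.
have -> : w * (- m * v) = - (v * (m * w)) by ring.
lra.
Qed.

(** The supremum of the left endpoints works, because every right endpoint bounds them all. *)
Lemma nested_intervals (a : nat -> R) w : 0 <= w ->
  (forall n, a n <= a n.+1 <= a n + w / 2 ^+ n.+1) ->
  exists x, forall n, a n <= x <= a n + w / 2 ^+ n.
Proof.
move=> w0 h.
have half n : w / 2 ^+ n = w / 2 ^+ n.+1 + w / 2 ^+ n.+1.
  by rewrite exprS; field; rewrite expf_neq0//; lra.
have up : {homo a : n m / (n <= m)%N >-> n <= m}.
  by apply: homo_leq => [//|x y z|n]; [exact: le_trans|case/andP: (h n)].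
have dn : {homo (fun n => a n + w / 2 ^+ n) : n m / (n <= m)%N >-> m <= n}.
  apply: homo_leq => [//|x y z /[swap]|n]; first exact: le_trans.
  by have := h n; have := half n; lra.
have ub n : ubound (range a) (a n + w / 2 ^+ n).
  move=> _ [m _ <-].
  have wn k : 0 <= w / 2 ^+ k by rewrite divr_ge0// exprn_ge0.
  have h1 := up _ _ (leq_maxl m n); have h2 := dn _ _ (leq_maxr m n).
  have := wn (maxn m n); lra.
exists (sup (range a)) => n; apply/andP; split.
  by apply: ub_le_sup; [exists (a 0%N + w / 2 ^+ 0); exact: ub|exists n].
by apply: ge_sup; [exists (a 0%N); exists 0%N|exact: ub].
Qed.

(** Goursat's argument: if the bound fails, it fails on some quarter, and the nested bad rectangles
    shrink to a point where [circulation_near] contradicts them. *)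
Lemma circulation_small P Q a c w v e : 0 <= w -> 0 <= v -> 0 < e ->
  (forall x y, a <= x <= a + w -> c <= y <= c + v -> closed_form_at P Q x y) ->
  exists N0, forall N, (N0 <= N)%N ->
    `|circulation N P Q a c w v| <= e * (w + v) ^+ 2.
Proof.
move=> w0 v0 e0 cl.
(* Only eventual validity in [N] is asked, so the level lost at each bisection is harmless. *)
pose good z n := exists N0, forall N, (N0 <= N)%N ->
  `|circulation N P Q z.1 z.2 (w / 2 ^+ n) (v / 2 ^+ n)|
  <= e * ((w / 2 ^+ n) + (v / 2 ^+ n)) ^+ 2.
suff : good (a, c) 0%N by rewrite /good /= !divr1.
apply: contrapT => bad0.
have half (u : R) n : u / 2 ^+ n / 2 = u / 2 ^+ n.+1.
  by rewrite exprS; field; rewrite expf_neq0//; lra.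
pose next n (z z' : R * R) :=
  (z'.1 = z.1 \/ z'.1 = z.1 + w / 2 ^+ n.+1) /\
  (z'.2 = z.2 \/ z'.2 = z.2 + v / 2 ^+ n.+1).
(* Badness is a premise under the existential so that [choice] yields a total successor function. *)
have step n z : exists z', ~ good z n -> next n z z' /\ ~ good z' n.+1.
  apply: contrapT => /forallNP all_bad.
  have G i j : next n z (i, j) -> good (i, j) n.+1.
    by move=> nx; apply: contrapT => ng; apply: (all_bad (i, j)) => _.
  apply: (all_bad z) => -[].
  have [N1 G1] := G z.1 z.2 ltac:(by split; left).
  have [N2 G2] := G (z.1 + w / 2 ^+ n.+1) z.2 ltac:(by split; [right|left]).
  have [N3 G3] := G z.1 (z.2 + v / 2 ^+ n.+1) ltac:(by split; [left|right]).
  have [N4 G4] := G (z.1 + w / 2 ^+ n.+1) (z.2 + v / 2 ^+ n.+1)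
    ltac:(by split; right).
  (* The successor pays for the level used by [circulationS]. *)
  exists (maxn (maxn N1 N2) (maxn N3 N4)).+1 => -[//|N].
  rewrite ltnS !geq_max => /andP[/andP[n1 n2] /andP[n3 n4]].
  rewrite circulationS !half.
  have -> : e * (w / 2 ^+ n + v / 2 ^+ n) ^+ 2 =
      4 * (e * (w / 2 ^+ n.+1 + v / 2 ^+ n.+1) ^+ 2).
    by rewrite -!half; field; rewrite expf_neq0//; lra.
  move: (G1 _ n1) (G2 _ n2) (G3 _ n3) (G4 _ n4).
  rewrite !ler_norml /=; lra.
have [nxt nxtP] := choice (fun nz : nat * (R * R) => step nz.1 nz.2).
pose z := fix z n := if n is n'.+1 then nxt (n', z n') else (a, c).
have bad n : ~ good (z n) n.
  by elim: n => //= n IH; case: (nxtP (n, z n) IH).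
have nx n : next n (z n) (z n.+1) by case: (nxtP (n, z n) (bad n)).
have pos (u : R) n : 0 <= u -> 0 <= u / 2 ^+ n.
  by move=> ?; rewrite divr_ge0// exprn_ge0.
have [|x hx] := @nested_intervals (fun n => (z n).1) w w0.
  by move=> n; have [[->|->] _] := nx n; have := pos w n.+1 w0; lra.
have [|y hy] := @nested_intervals (fun n => (z n).2) v v0.
  by move=> n; have [_ [->|->]] := nx n; have := pos v n.+1 v0; lra.
have [d d0 near_xy] := circulation_near (cl x y
  ltac:(have := hx 0%N; rewrite /= divr1//)
  ltac:(have := hy 0%N; rewrite /= divr1//)) e0.
have small (u : R) : 0 <= u -> exists n0, forall n, (n0 <= n)%N -> u / 2 ^+ n <= d.
  move=> u0; have [n0 hn0] : exists n0 : nat, u / d < n0%:R.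
    by exists (Num.bound (u / d)); apply: archi_boundP; rewrite divr_ge0// ltW.
  exists n0 => n n0n.
  have : n0%:R <= 2 ^+ n :> R.
    by rewrite -natrX ler_nat (leq_trans n0n)// ltnW// ltn_expl.
  rewrite ltr_pdivrMr// in hn0.
  rewrite ler_pdivrMr ?exprn_gt0// => h.
  have : n0%:R * d <= 2 ^+ n * d by rewrite ler_wpM2r// ltW.
  lra.
have [n1 h1] := small w w0; have [n2 h2] := small v v0.
pose n := maxn n1 n2.
apply: (bad n); exists 0%N => N _; apply: near_xy => //.
  by rewrite pos// h1// leq_maxl.
by rewrite pos// h2// leq_maxr.
Qed.

End DyadicSums.

Local Open Scope complex_scope.

(** * Schwarz's lemma *)

Section Complex.
Context {R : realType}.

(** [g] is the difference quotient, completed at [x] by the derivative. *)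
Lemma caratheodory_derivative (K : numFieldType) (f : K -> K) x :
  differentiable f x -> exists g, [/\ forall z, f z - f x = g z * (z - x),
    {for x, continuous g} & g x = (f^`())%classic x].
Proof.
move=> df.
exists (fun z => if z == x then (f^`())%classic x else (f z - f x) / (z - x)); split.
- move=> z; case: eqP => [->|/eqP]; first by rewrite !subrr mulr0.
  by rewrite -subr_eq0 => /divfK->.
- apply/continuous_withinNshiftx; rewrite eqxx /=.
  have /derivable1_diffP F0 := df.
  have F1 : (fun h => h^-1 *: (f (h + x) - f x)) @ 0^' --> (f^`())%classic x.
    rewrite derive1E; move: F0; rewrite /derivable /derive.
    set d := (fun _ : K => _); set d' := (fun _ : K => _).
    by suff -> : d = d' by []; rewrite funeqE=> h; rewrite /d /d' /= [h%:A](mulr1).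
  apply: cvg_trans F1; apply: near_eq_cvg; rewrite !fctE.
  near=> i.
  rewrite ifN; first by rewrite /= addrK mulrC.
  rewrite -subr_eq0 addrK.
  by near: i; rewrite near_withinE /= near_simpl; near=> x1.
by rewrite eqxx.
Unshelve. all: by end_near. Qed.

Lemma normc_real (r : R) : `|r%:C| = `|r|%:C.
Proof. by rewrite normc_def /= expr0n addr0 sqrtr_sqr. Qed.

Lemma normc_i : `|'i%C : R[i]| = 1.
Proof. by rewrite normc_def /= expr0n expr1n add0r sqrtr1. Qed.

Lemma normc_le_ReIm (z : R[i]) : `|z| <= (`|complex.Re z| + `|complex.Im z|)%:C.
Proof.
rewrite {1}[z]complexE (le_trans (ler_normD _ _))// normrM normc_i mul1r.
by rewrite !normc_real -rmorphD.
Qed.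

Lemma ler_norm_Re (z : R[i]) r : `|z| <= r%:C -> `|complex.Re z| <= r.
Proof. by move=> h; rewrite -lecR (le_trans (normc_ge_Re _)). Qed.

Lemma ler_norm_Im (z : R[i]) r : `|z| <= r%:C -> `|complex.Im z| <= r.
Proof.
move=> h; rewrite -normrN -ReiNIm; apply: ler_norm_Re.
by rewrite normrM normc_i mulr1.
Qed.

Lemma cvg_complex (T : Type) (F : set_system T) (FF : Filter F)
    (f g : T -> R) (a b : R) :
  f @ F --> a -> g @ F --> b -> (fun t => f t +i* g t) @ F --> a +i* b.
Proof.
move=> fa gb; apply/cvgrPdist_le => e e0.
have /complex_realP[r er] : e \is Num.real by rewrite gtr0_real.
move: e0; rewrite {}er ltcR => r0.
have r20 : 0 < r / 2 by lra.
move/cvgrPdist_le: fa => /(_ _ r20) fa; move/cvgrPdist_le: gb => /(_ _ r20) gb.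
near=> t.
rewrite (le_trans (normc_le_ReIm _))// lecR /= [leRHS]splitr.
by apply: lerD; near: t.
Unshelve. all: by end_near. Qed.

(** * Logarithmic polar coordinates and sums over circles *)

Definition cis (t : R) : R[i] := cos t +i* sin t.

(** The exponential of [s + i t]: it wraps a rectangle of height [2 pi] onto an annulus, which
    brings the rectangle lemma to bear on circles. *)
Definition polar (s t : R) : R[i] := (expR s)%:C * cis t.

Lemma norm_polar s t : `|polar s t| = (expR s)%:C.
Proof.
rewrite normrM normc_real normc_def /= cos2Dsin2 sqrtr1 mulr1.
by rewrite ger0_norm// expR_ge0.
Qed.

Lemma polar_periodic s : polar s (pi *+ 2) = polar s 0.
Proof. by rewrite /polar /cis cos2pi sin2pi cos0 sin0. Qed.

(** [A] and [B] play the partial derivatives in [s] and [t], and the last clause is the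
    Cauchy-Riemann equation. *)
Lemma polar_increment x y : exists A B : R * R -> R[i], [/\
  forall s t, polar s t - polar x y = A (s, t) * (s - x)%:C + B (s, t) * (t - y)%:C,
  {for (x, y), continuous A}, {for (x, y), continuous B}
  & B (x, y) = A (x, y) * 'i].
Proof.
have [ge [geE gec ge0]] :=
  (is_derive1_caratheodory expR x (expR x)).1 (is_derive_expR x).
have [gc [gcE gcc gc0]] :=
  (is_derive1_caratheodory cos y (- sin y)).1 (is_derive_cos y).
have [gs [gsE gsc gs0]] :=
  (is_derive1_caratheodory sin y (cos y)).1 (is_derive_sin y).
have c1 : (fun p : R * R => p.1) @ (x, y) --> x by exact: cvg_fst.
have c2 : (fun p : R * R => p.2) @ (x, y) --> y by exact: cvg_snd.
(* First [s] moves with the angle at [t], then the angle moves with the radius frozen at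
   [expR x]. *)
exists (fun p => (ge p.1)%:C * cis p.2), (fun p => (expR x)%:C * (gc p.2 +i* gs p.2)).
split.
- move=> s t; rewrite /polar /cis /=.
  have := geE s; have := gcE t; have := gsE t.
  move=> /(canRL (subrK _)) -> /(canRL (subrK _)) -> /(canRL (subrK _)) ->.
  by apply/eqP; rewrite eq_complex /=; apply/andP; split; apply/eqP; ring.
- apply: cvgM.
    apply: (@cvg_complex _ _ _ (fun p => ge p.1) (fun=> 0)); last exact: cvg_cst.
    exact: (cvg_comp _ _ c1 gec).
  apply: cvg_complex.
    exact: (cvg_comp _ _ c2 (@continuous_cos R y)).
  exact: (cvg_comp _ _ c2 (@continuous_sin R y)).
- apply: cvgM; first exact: cvg_cst.
  apply: cvg_complex; first exact: (cvg_comp _ _ c2 gcc).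
  exact: (cvg_comp _ _ c2 gsc).
- rewrite /= ge0 gc0 gs0 /cis.
  by apply/eqP; rewrite eq_complex /=; apply/andP; split; apply/eqP; ring.
Qed.

(* The form [-i k dw/w] in logarithmic polar coordinates; its real part is
   [Im k ds + Re k dt]. *)
Lemma closed_form_polar (k : R[i] -> R[i]) x y :
  differentiable k (polar x y) ->
  closed_form_at (fun s t => complex.Im (k (polar s t)))
                 (fun s t => complex.Re (k (polar s t))) x y.
Proof.
move=> /caratheodory_derivative[g [gE gc _]].
have [A [B [AB Ac Bc B0]]] := polar_increment x y.
have c1 : (fun p : R * R => p.1) @ (x, y) --> x by exact: cvg_fst.
have c2 : (fun p : R * R => p.2) @ (x, y) --> y by exact: cvg_snd.
have pc : (fun p : R * R => polar p.1 p.2) @ (x, y) --> polar x y.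
  apply: cvgM.
    apply: (@cvg_complex _ _ _ (fun p => expR p.1) (fun=> 0)); last exact: cvg_cst.
    exact: (cvg_comp _ _ c1 (@continuous_expR R x)).
  apply: cvg_complex; first exact: (cvg_comp _ _ c2 (@continuous_cos R y)).
  exact: (cvg_comp _ _ c2 (@continuous_sin R y)).
pose G (p : R * R) := g (polar p.1 p.2).
have Gc : G @ (x, y) --> G (x, y) by exact: (cvg_comp _ _ pc gc).
pose A' p := G p * A p; pose B' p := G p * B p.
have A'c : A' @ (x, y) --> A' (x, y) by exact: (cvgM Gc Ac).
have B'c : B' @ (x, y) --> B' (x, y) by exact: (cvgM Gc Bc).
have B'0 : B' (x, y) = A' (x, y) * 'i by rewrite /B' B0 /A' mulrA.
have kE s t : k (polar s t) - k (polar x y) =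
    A' (s, t) * (s - x)%:C + B' (s, t) * (t - y)%:C.
  by rewrite gE AB /A' /B' /G mulrDr !mulrA.
set a := A' (x, y) in B'0 A'c.
(* To first order [k] changes by [a ds + i a dt]; these are the coefficients of its imaginary and
   real parts, with [complex.Re a] common to both. *)
exists (complex.Im a), (complex.Re a), (- complex.Im a) => e e0.
have near_small (F : R * R -> R[i]) l : F @ (x, y) --> l ->
    exists2 d, 0 < d & forall s t, `|s - x| <= d -> `|t - y| <= d ->
      `|F (s, t) - l| <= e%:C.
  move=> /cvgrPdist_le /(_ e%:C); rewrite ltcR => /(_ e0).
  move=> /nbhs_ballP[d /= d0 H].
  exists (d / 2) => [|s t hs ht]; first lra.
  rewrite distrC; apply: (H (s, t)); split; rewrite /ball /= distrC; lra.
have [d1 d10 H1] := near_small _ _ A'c.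
have [d2 d20 H2] := near_small _ _ B'c.
exists (Num.min d1 d2) => [|s t]; first by rewrite lt_min d10.
rewrite !le_min => /andP[s1 s2] /andP[t1 t2].
have err : `|k (polar s t) - k (polar x y) - a * (s - x)%:C - B' (x, y) * (t - y)%:C|
    <= (e * (`|s - x| + `|t - y|))%:C.
  have -> : k (polar s t) - k (polar x y) - a * (s - x)%:C - B' (x, y) * (t - y)%:C =
      (A' (s, t) - a) * (s - x)%:C + (B' (s, t) - B' (x, y)) * (t - y)%:C.
    rewrite kE; ring.
  rewrite (le_trans (ler_normD _ _))// !normrM.
  rewrite !normc_real mulrDr rmorphD !rmorphM /=.
  by apply: lerD; apply: ler_wpM2r; rewrite ?ler0c//; [exact: H1|exact: H2].
split.
  have := ler_norm_Im err; rewrite B'0.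
  move: (k _) (k _) (a) => [? ?] [? ?] [? ?] /=.
  by congr (`|_| <= _); ring.
have := ler_norm_Re err; rewrite B'0.
move: (k _) (k _) (a) => [? ?] [? ?] [? ?] /=.
by congr (`|_| <= _); ring.
Qed.

(** The vertical sides of the rectangle map to the two circles, so small circulation forces the
    averages of [complex.Re (k w)] over them to agree up to [e]. *)
Lemma annulus_principle (k : R[i] -> R[i]) (r0 r1 L M : R) :
  0 < r0 -> r0 <= r1 ->
  (forall w, r0%:C <= `|w| <= r1%:C -> differentiable k w) ->
  (forall w, `|w| = r1%:C -> complex.Re (k w) <= M) ->
  (forall w, `|w| = r0%:C -> L <= complex.Re (k w)) -> L <= M.
Proof.
move=> r00 r01 dk kM Lk.
have r10 : 0 < r1 by lra.
have ln01 : ln r0 <= ln r1 by rewrite ler_ln.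
set Q := fun s t => complex.Re (k (polar s t)).
set P := fun s t => complex.Im (k (polar s t)).
have pi0 : 0 < pi *+ 2 :> R by rewrite pmulrn_rgt0// pi_gt0.
apply/ler_addgt0Pr => e e0.
have S0 : 0 < (ln r1 - ln r0 + pi *+ 2) ^+ 2 / (pi *+ 2).
  by rewrite divr_gt0// exprn_gt0//; lra.
(* Chosen so that Goursat's bound with [e / S] becomes [(pi *+ 2) * e]. *)
set S := _ / _ in S0.
have [||||N0 /(_ N0 (leqnn _))] := @circulation_small R P Q (ln r0) 0
    (ln r1 - ln r0) (pi *+ 2) (e / S).
- lra.
- exact: ltW.
- by rewrite divr_gt0.
- move=> x y hx _; apply: closed_form_polar; apply: dk.
  rewrite norm_polar !lecR -{1}(lnK r00) -{1}(lnK r10) !ler_expR; lra.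
have -> : e / S * (ln r1 - ln r0 + pi *+ 2) ^+ 2 = (pi *+ 2) * e.
  rewrite /S; field.
  apply/andP; split; lra.
rewrite /circulation add0r subrKC.
(* By periodicity the horizontal sides cancel. *)
have -> : P^~ (pi *+ 2) = P^~ 0 by apply/funext => s; rewrite /P polar_periodic.
move=> h.
have h1 : dyadic_sum N0 (Q (ln r1)) 0 (pi *+ 2) <= (pi *+ 2) * M.
  rewrite -(dyadic_sum_cst N0 M 0); apply: dyadic_sum_mono => [|t]; first exact: ltW.
  by apply: kM; rewrite norm_polar lnK.
have h0 : (pi *+ 2) * L <= dyadic_sum N0 (Q (ln r0)) 0 (pi *+ 2).
  rewrite -(dyadic_sum_cst N0 L 0); apply: dyadic_sum_mono => [|t]; first exact: ltW.
  by apply: Lk; rewrite norm_polar lnK.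
rewrite -(ler_pM2l pi0) mulrDr.
move: h; rewrite ler_norml => /andP[h _].
lra.
Qed.

End Complex.

Section Schwarz.
Context {R : realType}.

(* The odd part of [h] kills [h 0], so that [k] is bounded near [0]. *)
Lemma schwarz_derivative (h : R[i] -> R[i]) :
  holomorphic_on (unit_disc R) h ->
  (forall w, unit_disc R w -> unit_disc R (h w)) ->
  `|(h^`())%classic 0| <= 1.
Proof.
move=> dh h1.
have disc0 : unit_disc R 0 by rewrite /unit_disc /= normr0.
have [g [gE gc g0]] := caratheodory_derivative (dh 0 disc0).
set D := (h^`())%classic 0 in g0 *.
have [->|D0] := eqVneq D 0; first by rewrite normr0.
have [r rE] : exists r, `|D| = r%:C.
  by apply/complex_realP; rewrite normr_real.
have r0 : 0 < r by rewrite -ltcR -rE normr_gt0.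
(* A unimodular factor rotating [D] to its modulus, so that real parts suffice. *)
pose c := D^*%C / r%:C.
have c1 : `|c| = 1.
  by rewrite normrM normcJ rE normfV normc_real gtr0_norm// divff// -rE normr_eq0.
have cD : c * D = r%:C.
  by rewrite /c mulrAC [_ * D]mulrC -sqr_normc rE expr2 mulfK// -rE normr_eq0.
clearbody c; rewrite rE lecR; apply/ler_addgt0Pr => e e0.
(* This tends to [c * D], that is [r], at the origin. *)
pose k w := c * ((h w - h (- w)) * (w + w)^-1).
have kE w : w != 0 -> k w = c * ((g w + g (- w)) / 2).
  move=> w0; rewrite /k; have -> : h w - h (- w) = (g w + g (- w)) * w.
    transitivity ((h w - h 0) - (h (- w) - h 0)); first by rewrite opprB addrA subrK.
    by rewrite !gE !subr0 mulrN opprK mulrDl.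
  by field; rewrite -mulr2n -mulr_natr mulf_neq0.
have [d d0 near0] : exists2 d : R, 0 < d & forall w, w != 0 -> `|w| <= d%:C ->
    r - e / 2 <= complex.Re (k w).
  have e20 : (0 : R[i]) < (e / 2)%:C by rewrite ltcR; lra.
  move/cvgrPdist_le: gc => /(_ _ e20) /nbhs_ballP[b /= b0 H].
  have /complex_realP[d dE] : b \is Num.real by rewrite gtr0_real.
  rewrite {}dE ltcR in b0 H.
  exists (d / 2) => [|w w0 wd]; first lra.
  have wb : `|w| < d%:C by rewrite (le_lt_trans wd)// ltcR; lra.
  have H1 : `|D - g w| <= (e / 2)%:C.
    by rewrite -g0; apply: H; rewrite /ball /= sub0r normrN.
  have H2 : `|D - g (- w)| <= (e / 2)%:C.
    by rewrite -g0; apply: H; rewrite /ball /= sub0r normrN normrN.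
  have : `|r%:C - k w| <= (e / 2)%:C.
    rewrite kE// -cD -mulrBr normrM c1 mul1r.
    have -> : D - (g w + g (- w)) / 2 = (D - g w) / 2 + (D - g (- w)) / 2 by field.
    rewrite (le_trans (ler_normD _ _))// !normrM normfV normr_nat.
    by rewrite -mulrDl ler_pdivrMr// mulr_natr mulr2n lerD.
  move=> /ler_norm_Re; case: (k w) => ? ? /=; rewrite ler_norml; lra.
(* On the circle of radius [r1] the modulus of [k] is at most [2 / (2 * r1)], which is
   [1 + e / 2]. *)
pose r1 := (1 + e / 2)^-1.
have r10 : 0 < r1 by rewrite invr_gt0; lra.
have r11 : r1 < 1 by rewrite invf_lt1; lra.
have disc w : `|w| <= r1%:C -> unit_disc R w.
  by move=> wr; rewrite /unit_disc /= (le_lt_trans wr)// ltcR.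
suff : r - e / 2 <= 1 + e / 2 by lra.
apply: (@annulus_principle R k (Num.min d r1) r1).
- by rewrite lt_min d0.
- by rewrite ge_min lexx orbT.
- move=> w /andP[w0 /disc wr].
  have wn0 : w != 0.
    by rewrite -normr_gt0 (lt_le_trans _ w0)// ltcR lt_min d0.
  have dw : differentiable h w by exact: dh.
  have dNw : differentiable h (- w).
    by apply: dh; rewrite /unit_disc /= normrN.
  have w20 : w + w != 0 by rewrite -mulr2n -mulr_natr mulf_neq0.
  have d1 : differentiable (h \o -%R) w.
    by apply: differentiable_comp dNw; exact: differentiableN.
  have d2 : differentiable (fun w : R[i] => w + w) w.
    have did : differentiable (@id R[i]) w by exact: ex_diff.
    exact: (differentiableD did did).
  have d3 := differentiableV d2 w20.
  exact: (differentiableM (differentiable_cst c w)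
    (differentiableM (differentiableB dw d1) d3)).
- move=> w wr; have dw : unit_disc R w by apply: disc; rewrite wr.
  have dNw : unit_disc R (- w) by rewrite /unit_disc /= normrN.
  rewrite -lecR (le_trans _ (_ : `|k w| <= _))//.
    by rewrite (le_trans _ (normc_ge_Re _))// lecR ler_norm.
  rewrite /k !normrM c1 mul1r normfV -mulr2n normrMn wr.
  rewrite ler_pdivrMr; last by rewrite pmulrn_rgt0// ltcR.
  rewrite -rmorphMn -rmorphM /= mulrnAr -/(r1^-1).
  rewrite -[1 + e / 2]invrK -/r1 mulVf ?gt_eqF//.
  rewrite (le_trans (ler_normB _ _))// rmorphMn mulr2n rmorph1.
  by apply: lerD; apply: ltW; exact: h1.
- move=> w wd; apply: near0.
    by rewrite -normr_gt0 wd ltcR lt_min d0.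
  by rewrite wd lecR ge_min lexx.
Qed.

End Schwarz.

(** * The two metrics on the ball and on the product *)

Section Metrics.
Context {R : realType}.

(** A disc [g] in [D] followed by [f] is a self-map of the unit disc with derivative [a] times
    ['d f z xi] at [0]; Schwarz bounds it by 1. *)
Lemma caratheodory_le_kobayashi n (D : set 'rV[R[i]]_n) z xi :
  (caratheodory_metric D z xi <= kobayashi_metric D z xi)%E.
Proof.
apply: ge_ereal_sup => _ [f [fh fD] <-].
apply: le_ereal_inf_tmp => _ [a [a0 [g [gh gD g0 g'0]]] <-].
have disc0 : unit_disc R 0 by rewrite /unit_disc /= normr0.
have dg := gh 0 disc0.
have df : differentiable f (g 0) by apply: fh; exact: gD.
have : `|((f \o g)^`())%classic 0| <= 1.
  apply: schwarz_derivative => w w1; last by apply: fD; exact: gD.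
  by apply: differentiable_comp; [exact: gh|apply: fh; exact: gD].
rewrite derive1E'; last exact: differentiable_comp.
rewrite diff_comp//= -derive1E'// g'0 g0 linearZ /=; move: ('d f z xi) => q.
rewrite normrM normc_real (gtr0_norm a0) [`|q|]normc_def.
rewrite lee_fin -rmorphM (lecR _ 1) => h.
by rewrite -[leRHS]mul1r ler_pdivlMr// mulrC; case: q h.
Qed.

(** Expanding in the standard basis makes [f] a sum of coordinates times constants, hence
    continuous. *)
Lemma is_diff_linear_rV (K : numFieldType) n (f : 'rV[K]_n -> K) z :
  linear f -> is_diff z f f.
Proof.
move=> lf.
pose flM := GRing.isLinear.Build K 'rV[K]_n K^o _ f lf.
pose fL : {linear 'rV[K]_n -> K^o} := HB.pack f flM.
have df x : differentiable (fL : 'rV[K]_n -> K) x.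
  have -> : (fL : 'rV[K]_n -> K) =
      \sum_(j < n) (fun u : 'rV[K]_n => u 0 j * fL (delta_mx 0 j)).
    apply/funext => u; rewrite fct_sumE {1}[u]row_sum_delta linear_sum.
    by apply: eq_bigr => j _; rewrite linearZ.
  apply: differentiable_sum => j.
  apply: differentiableM; first exact: differentiable_coord.
  exact: differentiable_cst.
apply: DiffDef; first exact: df.
have := @diff_lin K _ K^o fL z (fun x => differentiable_continuous (df x)).
by [].
Qed.

(** The disc automorphism taking [0] to [s]. A real [s] suffices because phases are absorbed into
    the unit vectors [e j]. *)
Definition mobius (s : R) (z : R[i]) : R[i] := (z + s%:C) / (1 + s%:C * z).

Lemma norm_lt1 (z : R[i]) :
  (`|z| < 1) <-> (complex.Re z ^+ 2 + complex.Im z ^+ 2 < 1).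
Proof. by rewrite -ltcR add_Re2_Im2 expr_lt1. Qed.

Lemma mobius_den_neq0 (s : R) (z : R[i]) : -1 < s < 1 -> `|z| < 1 -> 1 + s%:C * z != 0.
Proof.
move=> hs /(norm_lt1 _).1; case: z => a b /= h.
rewrite (@eq_complex R) negb_and /=.
apply/orP; left; apply: lt0r_neq0; rewrite mul0r subr0.
have ha : -1 < a < 1 by apply/andP; split; nra.
nra.
Qed.

Lemma norm_mobius_lt1 (s : R) (z : R[i]) : -1 < s < 1 -> `|z| < 1 -> `|mobius s z| < 1.
Proof.
move=> hs z1; have d0 := mobius_den_neq0 hs z1.
rewrite normrM normfV ltr_pdivrMr ?normr_gt0// mul1r.
rewrite -(ltr_pXn2r (ltn0Sn 1)) ?nnegrE ?normr_ge0//.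
move: z1 => /(norm_lt1 _).1; rewrite -!add_Re2_Im2 ltcR; case: z {d0} => a b /= h.
(* This product is the squared modulus of the denominator minus that of the numerator. *)
have : 0 < (1 - s ^+ 2) * (1 - (a ^+ 2 + b ^+ 2)) by rewrite mulr_gt0//; nra.
move: h => _; lra.
Qed.

Lemma is_derive_mobius (s : R) (z : R[i]) : 1 + s%:C * z != 0 ->
  is_derive z 1 (mobius s) ((1 - s ^+ 2)%:C / (1 + s%:C * z) ^+ 2).
Proof.
move=> d0.
have dN : is_derive z 1 ((id : R[i] -> R[i]) + cst s%:C) (1 + 0).
  exact: is_deriveD.
pose D : R[i] -> R[i] := cst 1 + s%:C *: (id : R[i] -> R[i]).
have dD : is_derive z 1 D (0 + s%:C *: 1) by apply: is_deriveD.
have Dz : D z != 0 by exact: d0.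
have dV : is_derive z 1 (fun y => (D y)^-1) (- (D z) ^- 2 *: (0 + s%:C *: 1)).
  case: dD => [e1 e2]; split; first exact: derivableV Dz e1.
  by rewrite -e2; exact: deriveV Dz e1.
apply: is_derive_eq (is_deriveM dN dV) _.
transitivity ((z + s%:C) * (- (1 + s%:C * z) ^- 2 * (0 + s%:C * 1))
  + (1 + s%:C * z)^-1 * (1 + 0)); first by [].
by rewrite rmorphB rmorphXn rmorph1; field.
Qed.

End Metrics.

(** * Hermitian geometry and the metrics at the centre of the ball *)

Section Ball.
Context {R : realType}.
Implicit Types (s t : R).

Definition sqn n (x : 'rV[R[i]]_n) : R :=
  \sum_(j < n) (complex.Re (x 0 j) ^+ 2 + complex.Im (x 0 j) ^+ 2).

Lemma sqnE n (x : 'rV[R[i]]_n) : (sqn x)%:C = \sum_(j < n) `|x 0 j| ^+ 2.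
Proof. by rewrite rmorph_sum; apply: eq_bigr => j _; rewrite -add_Re2_Im2. Qed.

Lemma unit_ballE n (x : 'rV[R[i]]_n) : unit_ball R n x <-> sqn x < 1.
Proof. by rewrite /unit_ball /= -sqnE (ltcR _ 1). Qed.

Lemma sqn_ge0 n (x : 'rV[R[i]]_n) : 0 <= sqn x.
Proof. by apply: sumr_ge0 => j _; rewrite addr_ge0 ?sqr_ge0. Qed.

Lemma sqnZ n (c : R[i]) (x : 'rV[R[i]]_n) : (sqn (c *: x))%:C = `|c| ^+ 2 * (sqn x)%:C.
Proof.
by rewrite !sqnE mulr_sumr; apply: eq_bigr => j _; rewrite mxE normrM exprMn.
Qed.

Lemma sqnZr n s (x : 'rV[R[i]]_n) : sqn (s%:C *: x) = s ^+ 2 * sqn x.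
Proof.
apply: complexI; rewrite sqnZ normc_real -rmorphXn real_normK ?num_real//.
by rewrite -rmorphM.
Qed.

Lemma sqn_parallelogram n (x y : 'rV[R[i]]_n) :
  sqn (x + y) + sqn (x - y) = 2 * (sqn x + sqn y).
Proof.
rewrite /sqn -!big_split /= mulr_sumr; apply: eq_bigr => j _; rewrite !mxE.
by case: (x 0 j) (y 0 j) => [a b] [c d] /=; ring.
Qed.

Definition hdot n (e z : 'rV[R[i]]_n) : R[i] := \sum_(j < n) z 0 j * (e 0 j)^*%C.

Lemma hdot_linear n (e : 'rV[R[i]]_n) : linear (hdot e).
Proof.
move=> a u v; rewrite /hdot scaler_sumr -big_split /=; apply: eq_bigr => j _.
by rewrite !mxE mulrDl scalerAl.
Qed.

Lemma hdotxx n (e : 'rV[R[i]]_n) : hdot e e = (sqn e)%:C.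
Proof. by rewrite sqnE; apply: eq_bigr => j _; rewrite -sqr_normc. Qed.

(** Expanding the squared norm of [z - c *: e] leaves [sqn z] minus the squared modulus of [c] times
    [2 - sqn e], and that last factor is at least 1. *)
Lemma norm_hdot_le n (e z : 'rV[R[i]]_n) : sqn e <= 1 ->
  `|hdot e z| ^+ 2 <= (sqn z)%:C.
Proof.
move=> e1; set c := hdot e z.
have : 0 <= \sum_(j < n) `|z 0 j - c * e 0 j| ^+ 2.
  by apply: sumr_ge0 => j _; rewrite exprn_ge0.
have -> : \sum_(j < n) `|z 0 j - c * e 0 j| ^+ 2 =
    (sqn z)%:C - `|c| ^+ 2 * (2 - (sqn e)%:C).
  have cJ : \sum_(j < n) (z 0 j)^*%C * e 0 j = c^*%C.
    by rewrite rmorph_sum; apply: eq_bigr => j _; rewrite rmorphM /= conjcK.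
  transitivity (\sum_(j < n) (`|z 0 j| ^+ 2 - c^*%C * (z 0 j * (e 0 j)^*%C)
      - c * ((z 0 j)^*%C * e 0 j) + c * c^*%C * `|e 0 j| ^+ 2)).
    apply: eq_bigr => j _; rewrite !sqr_normc rmorphB rmorphM /=; ring.
  rewrite big_split /= !sumrB -!mulr_sumr -!sqnE -/(hdot e z) -/c cJ sqr_normc.
  ring.
rewrite subr_ge0; apply: le_trans; rewrite -[leLHS]mulr1 ler_wpM2l ?exprn_ge0//.
by rewrite lerBrDl -lerBrDr (_ : 2 - 1 = 1%:C) ?lecR// ; ring.
Qed.

(** Positive dimension supplies a unit vector when [p = 0]. *)
Lemma polar_decomposition n (p : 'rV[R[i]]_n) : (0 < n)%N ->
  exists s e, [/\ 0 <= s, sqn e = 1 & p = s%:C *: e].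
Proof.
case: n p => // n p _.
have [->|p0] := eqVneq p 0.
  exists 0, (delta_mx 0 0); split => //; last by rewrite scale0r.
  apply: complexI; rewrite sqnE (bigD1 0)//= big1 ?mxE ?eqxx ?normr1 ?expr1n ?addr0//.
  by move=> j /negbTE j0; rewrite mxE j0 normr0 expr0n.
have [j pj] : exists j, p 0 j != 0.
  apply/existsP; rewrite -negb_forall; apply: contra p0 => /forallP H.
  by apply/eqP/rowP => j; rewrite mxE; exact/eqP.
have sp : 0 < sqn p.
  rewrite -ltcR sqnE (bigD1 j)//=.
  by rewrite ltr_wpDr ?exprn_gt0 ?normr_gt0// sumr_ge0// => k _; rewrite exprn_ge0.
exists (Num.sqrt (sqn p)), ((Num.sqrt (sqn p))^-1%:C *: p).
have s0 : Num.sqrt (sqn p) != 0 by rewrite gt_eqF// sqrtr_gt0.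
split; first exact: sqrtr_ge0.
  by rewrite sqnZr exprVn sqr_sqrtr ?sqn_ge0// mulVf// gt_eqF.
by rewrite scalerA -rmorphM /= divff// scale1r.
Qed.

Lemma caratheodory_ball_ge n (x : 'rV[R[i]]_n) :
  ((Num.sqrt (sqn x))%:E <= caratheodory_metric (unit_ball R n) 0 x)%E.
Proof.
(* The functional is dual to the direction of [x]; for [x = 0] the convention [0^-1 = 0] gives
   [e = 0], which still works. *)
set r := Num.sqrt (sqn x); pose e := (r^-1)%:C *: x.
have rr : r ^+ 2 = sqn x by rewrite sqr_sqrtr// sqn_ge0.
have e1 : sqn e <= 1.
  rewrite sqnZr -rr -exprMn; have [->|r0] := eqVneq r 0.
    by rewrite mulr0 expr0n.
  by rewrite mulVf// expr1n.
have df z := is_diff_linear_rV z (hdot_linear e).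
have ex : hdot e x = r%:C.
  rewrite /hdot /e; transitivity (\sum_(j < n) (r^-1)%:C * (x 0 j * (x 0 j)^*%C)).
    apply: eq_bigr => j _; rewrite mxE.
    have -> : ((r^-1)%:C * x 0 j)^*%C = (r^-1)%:C * (x 0 j)^*%C.
      by rewrite rmorphM; congr (_ * _); exact: conjc_real.
    ring.
  rewrite -mulr_sumr -/(hdot x x) hdotxx -rmorphM -rr.
  by have [->|r0] := eqVneq r 0; [rewrite expr0n mulr0|rewrite expr2 mulKf].
apply: ereal_sup_ubound; exists (hdot e).
  split=> [z _|z /unit_ballE z1]; first by case: (df z).
  rewrite /unit_disc /= -(expr_lt1 (ltn0Sn 1))//.
  by rewrite (le_lt_trans (norm_hdot_le _ e1))// (ltcR _ 1).
case: (df 0) => _ ->; rewrite ex normc_real /=.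
by rewrite ger0_norm// sqrtr_ge0.
Qed.

(** The linear disc in direction [x / t] is a competitor; strictness keeps [t] positive even for
    [x = 0]. *)
Lemma kobayashi_ball_le n (x : 'rV[R[i]]_n) t : Num.sqrt (sqn x) < t ->
  (kobayashi_metric (unit_ball R n) 0 x <= t%:E)%E.
Proof.
move=> xt; have t0 : 0 < t by rewrite (le_lt_trans _ xt)// sqrtr_ge0.
apply: ereal_inf_lbound; exists t^-1; last by rewrite invrK.
split; first by rewrite invr_gt0.
pose y := (t^-1)%:C *: x.
have y1 : sqn y < 1.
  rewrite sqnZr exprVn mulrC ltr_pdivrMr ?exprn_gt0// mul1r.
  by rewrite -(sqr_sqrtr (sqn_ge0 x)) ltr_pXn2r// nnegrE ?sqrtr_ge0// ltW.
have dy (w : R[i]) := is_diff_scalel w y.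
exists (fun w => w *: y); split=> [w _|w w1||].
- by case: (dy w).
- apply/unit_ballE; rewrite -ltcR sqnZ.
  have w1' : `|w| ^+ 2 < 1 by rewrite expr_lt1.
  have [->|sy] := eqVneq (sqn y) 0; first by rewrite mulr0 ltcR.
  rewrite (lt_trans _ (_ : (sqn y)%:C < 1)) ?(ltcR _ 1)//.
  by rewrite -[ltRHS]mul1r ltr_pM2r// ltcR lt_neqAle eq_sym sy sqn_ge0.
- by rewrite scale0r.
- by case: (dy 0) => d0 dE; rewrite derive1E'// dE scale1r.
Qed.

End Ball.

(** * Discs and functionals on the product *)

Section Product.
Context {R : realType}.

Lemma diff_mobius (s : R) (z : R[i]) : -1 < s < 1 -> `|z| < 1 ->
  is_diff z (mobius s) ( *:%R^~ ((1 - s ^+ 2)%:C / (1 + s%:C * z) ^+ 2)).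
Proof.
move=> s1 z1; have [dm mE] := is_derive_mobius (mobius_den_neq0 s1 z1).
apply: DiffDef; first exact/derivable1_diffP.
by rewrite deriv1E// derive1E mE.
Qed.

Lemma diff_mobius_scale (s : R) (a w : R[i]) : -1 < s < 1 -> `|a * w| < 1 ->
  is_diff w (fun w => mobius s (a * w))
    (fun h => a * h * ((1 - s ^+ 2)%:C / (1 + s%:C * (a * w)) ^+ 2)).
Proof.
move=> s1 w1; have dl : is_diff w (fun w => a * w) (fun h => a * h).
  exact: (is_diff_scaler a w).
exact: (@is_diff_comp _ _ _ _ _ _ _ _ w dl (diff_mobius s1 w1)).
Qed.

Context (m : nat) (n_ : 'I_m -> nat) (e : forall j, 'rV[R[i]]_(n_ j)).
Context (e1 : forall j, sqn (e j) = 1).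
Implicit Types (c sg : 'I_m -> R[i]) (s : 'I_m -> R).

(** A linear embedding of the coefficient space, one complex line per block; the base point, the
    tangent vectors and the discs all lie in its image. *)
Definition along c : 'rV[R[i]]_(\sum_(j < m) n_ j) := \mxrow_j (c j *: e j).

Lemma submxrow_along c j : submxrow (along c) j = c j *: e j.
Proof. exact: mxrowK. Qed.

Lemma submxrowZ (a : R[i]) (A : 'rV[R[i]]_(\sum_(j < m) n_ j)) j :
  submxrow (a *: A) j = a *: submxrow A j.
Proof. by apply/matrixP => p q; rewrite !mxE. Qed.

Lemma along_sum c : along c = \sum_(j < m) c j *: along (fun k => (k == j)%:R).
Proof.
apply/mxrowP => j; rewrite submxrow_along submxrow_sum (bigD1 j)//= -[LHS]addr0.
congr (_ + _); first by rewrite submxrowZ submxrow_along eqxx scale1r.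
by apply/esym/big1 => k kj; rewrite submxrowZ submxrow_along eq_sym (negbTE kj) scale0r scaler0.
Qed.

Lemma along_in_product c : (forall j, `|c j| < 1) -> product_of_balls R n_ (along c).
Proof.
move=> c1 j; apply/unit_ballE; rewrite submxrow_along -ltcR sqnZ e1 mulr1.
by rewrite expr_lt1.
Qed.

(** All blocks move at once: coefficient [j] follows [mobius (s j)] at [sg j * w], with velocity
    [(1 - s j ^+ 2) * sg j] at [0], so the scale 1 is admissible. *)
Lemma kobayashi_product_le s sg : (forall j, -1 < s j < 1) ->
  (forall j, `|sg j| <= 1) ->
  (kobayashi_metric (product_of_balls R n_) (along (fun j => (s j)%:C))
    (along (fun j => (1 - s j ^+ 2)%:C * sg j)%R) <= 1)%E.
Proof.
move=> s1 sg1; apply: ereal_inf_lbound; exists 1; last by rewrite invr1.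
split=> //.
have lt1 j w : `|w| < 1 -> `|sg j * w| < 1.
  by move=> w1; rewrite normrM (le_lt_trans _ w1)// ler_piMl.
pose phi j (w : R[i]) := mobius (s j) (sg j * w).
have phiD j w (w1 : `|w| < 1) := diff_mobius_scale (s1 j) (lt1 j _ w1).
have dphi j w : `|w| < 1 -> differentiable (phi j) w.
  by move=> w1; case: (phiD j w w1).
have phi'0 j : 'd (phi j) 0 1 = (1 - s j ^+ 2)%:C * sg j.
  have n01 : `|0 : R[i]| < 1 by rewrite normr0.
  have [_ ->] := phiD j 0 n01.
  by rewrite !mulr0 addr0 expr1n divr1 mulr1 mulrC.
have [disc0 gE] : `|0 : R[i]| < 1 /\
    (fun w => along (phi^~ w)) = \sum_(j < m) (fun w => phi j w *: along (fun k => (k == j)%:R)).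
  split; first by rewrite normr0.
  by apply/funext => w; rewrite along_sum fct_sumE.
have dg w : `|w| < 1 -> differentiable (fun w => along (phi^~ w)) w.
  move=> w1; rewrite gE; apply: differentiable_sum => j.
  by apply: differentiableZl; exact: dphi.
exists (fun w => along (phi^~ w)); split=> [//|w w1||].
- by apply: along_in_product => j; apply: norm_mobius_lt1; [exact: s1|exact: lt1].
- by congr along; apply/funext => j; rewrite /phi /mobius !mulr0 add0r addr0 divr1.
- rewrite derive1E gE derive_sum; last first.
    by move=> j; apply/diff_derivable/differentiableZl; exact: dphi.
  rewrite scale1r [RHS]along_sum; apply: eq_bigr => j _.
  rewrite deriveE; last by apply: differentiableZl; exact: dphi.
  by rewrite (diffZl _ (dphi j 0 disc0)) phi'0.
Qed.

(** Projecting onto [e i] and moving [s i] to [0] by a Mobius map has derivative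
    [1 / (1 - s i ^+ 2)] there, cancelling the factor in the tangent vector. *)
Lemma caratheodory_product_ge s i : (forall j, -1 < s j < 1) ->
  (1 <= caratheodory_metric (product_of_balls R n_) (along (fun j => (s j)%:C))
    (along (fun j => (1 - s j ^+ 2)%:C * (j == i)%:R)%R))%E.
Proof.
move=> s1; apply: ereal_sup_ubound.
pose l (z : 'rV[R[i]]_(\sum_(j < m) n_ j)) := hdot (e i) (submxrow z i).
have ll : linear l.
  move=> a u v; rewrite /l -hdot_linear; congr hdot.
  by apply/matrixP => p q; rewrite !mxE.
have dl z := is_diff_linear_rV z ll.
have lE c : l (along c) = c i.
  rewrite /l submxrow_along /hdot.
  transitivity (\sum_(j < n_ i) c i * (e i 0 j * (e i 0 j)^*%C)).
    by apply: eq_bigr => j _; rewrite mxE mulrA.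
  by rewrite -mulr_sumr -/(hdot (e i) (e i)) hdotxx e1 mulr1.
have sN : -1 < - s i < 1 by have := s1 i; lra.
have lD z : product_of_balls R n_ z -> `|l z| < 1.
  move=> /(_ i) /unit_ballE z1; rewrite -(expr_lt1 (ltn0Sn 1))//.
  rewrite (le_lt_trans (norm_hdot_le _ _)) ?e1//.
  by rewrite (ltcR _ 1).
have df z : product_of_balls R n_ z -> differentiable (mobius (- s i) \o l) z.
  move=> zD; apply: differentiable_comp; first by case: (dl z).
  by case: (diff_mobius sN (lD _ zD)).
exists (mobius (- s i) \o l).
  by split=> // z zD; apply: norm_mobius_lt1 => //; exact: lD.
set p := along _.
have pD : product_of_balls R n_ p.
  by apply: along_in_product => j; rewrite normc_real (ltcR _ 1) ltr_norml.
have s0 : 1 - s i ^+ 2 != 0 by rewrite gt_eqF//; have := s1 i; nra.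
have -> : 'd (mobius (- s i) \o l) p (along (fun j => (1 - s j ^+ 2)%:C * (j == i)%:R)) = 1.
  have [d1 d1E] := dl p; have [d2 d2E] := diff_mobius sN (lD _ pD).
  rewrite (diff_comp d1 d2) d1E d2E /= !lE eqxx mulr1.
  have -> : 1 + (- s i)%:C * (s i)%:C = (1 - s i ^+ 2)%:C.
    by rewrite rmorphN rmorphB rmorphXn; ring.
  rewrite sqrrN /GRing.scale /=.
  have : (1 - s i ^+ 2)%:C != 0 :> R[i] by rewrite (inj_eq (@complexI R) _ 0).
  by move: (1 - s i ^+ 2)%:C => q q0; field.
by rewrite normr1.
Qed.

End Product.

(** * The isometry *)

Section RealDifferential.
Context {R : realType}.

Lemma of_realK n : cancel (@of_real R n) (@to_real R n).
Proof.
move=> x; rewrite -[RHS]hsubmxK /to_real.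
by congr row_mx; apply/rowP => j; rewrite !mxE /= ?mxE.
Qed.

Lemma to_realK n : cancel (@to_real R n) (@of_real R n).
Proof.
move=> z; rewrite /of_real /to_real row_mxKl row_mxKr.
by apply/rowP => j; rewrite !mxE; case: (z 0 j).
Qed.

Lemma to_realD n (u v : 'rV[R[i]]_n) : to_real (u + v) = to_real u + to_real v.
Proof.
rewrite /to_real add_row_mx; congr row_mx; apply/rowP => j; rewrite !mxE.
  by case: (u 0 j) (v 0 j) => [? ?] [? ?].
by case: (u 0 j) (v 0 j) => [? ?] [? ?].
Qed.

Lemma to_realN n (u : 'rV[R[i]]_n) : to_real (- u) = - to_real u.
Proof.
by rewrite /to_real opp_row_mx; congr row_mx; apply/rowP => j; rewrite !mxE;
  case: (u 0 j).
Qed.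

Lemma real_diffD n p (f : 'rV[R[i]]_n -> 'rV[R[i]]_p) z u v :
  real_diff f z (u + v) = real_diff f z u + real_diff f z v.
Proof.
by apply: (can_inj (@to_realK p)); rewrite to_realD !of_realK to_realD linearD.
Qed.

Lemma real_diffB n p (f : 'rV[R[i]]_n -> 'rV[R[i]]_p) z u v :
  real_diff f z (u - v) = real_diff f z u - real_diff f z v.
Proof.
apply: (can_inj (@to_realK p)).
by rewrite to_realD to_realN !of_realK to_realD to_realN linearB.
Qed.

(** Makes [g \o f] the identity near the origin in real coordinates, so that the two have the same
    derivative there. *)
Lemma near_unit_ball n :
  \forall x \near (to_real 0 : 'rV[R]_(n + n)), unit_ball R n (of_real x).
Proof.
set o := to_real 0.
have sE (x : 'rV[R]_(n + n)) : sqn (of_real x) =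
    \sum_(j < n) (x 0 (lshift n j) * x 0 (lshift n j) + x 0 (rshift n j) * x 0 (rshift n j)).
  by apply: eq_bigr => j _; rewrite !mxE.
have o1 : \sum_(j < n) (o 0 (lshift n j) * o 0 (lshift n j) + o 0 (rshift n j) * o 0 (rshift n j)) < 1.
  rewrite -sE to_realK /sqn big1// => j _; by rewrite mxE /= expr0n addr0.
have : continuous (fun x : 'rV[R]_(n + n) =>
    \sum_(j < n) (x 0 (lshift n j) * x 0 (lshift n j) + x 0 (rshift n j) * x 0 (rshift n j))).
  apply: continuous_big => [|j _ x]; first exact: add_continuous.
  have c k : (fun y : 'rV[R]_(n + n) => y 0 k) @ x --> x 0 k.
    exact: coord_continuous.
  exact: (cvgD (cvgM (c _) (c _)) (cvgM (c _) (c _))).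
move=> /(_ o) /cvgr_lt /(_ _ o1); apply: filterS => x x1.
by apply/unit_ballE; rewrite sE.
Qed.

(** The chain rule gives [F *m G = 1%:M] for the Jacobians; being square, they also satisfy
    [G *m F = 1%:M]. *)
Lemma real_diff_surjective n (f g : 'rV[R[i]]_n -> 'rV[R[i]]_n)
    (a : 'rV[R[i]]_n) :
  (forall z, unit_ball R n z -> g (f z) = z) ->
  differentiable (realified f) (to_real 0) ->
  differentiable (realified g) (to_real (f 0)) ->
  exists u, real_diff f 0 u = a.
Proof.
move=> gf df dg.
set o := to_real 0 in df *.
have fo : realified f o = to_real (f 0) by rewrite /realified /= to_realK.
rewrite -fo in dg.
pose F := jacobian (realified f) o; pose G := jacobian (realified g) (realified f o).
have FG : F *m G = 1%:M.
  apply/row_matrixP => i; rewrite row1 !rowE.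
  have : 'D_(delta_mx 0 i) (realified g \o realified f) o = 'D_(delta_mx 0 i) id o.
    apply: near_eq_derive; have := near_unit_ball n; apply: filterS => x xB.
    by rewrite /realified /= to_realK gf// of_realK.
  rewrite derive_id (deriveE _ (differentiable_comp df dg)) (diff_comp df dg) /= => h.
  rewrite mulmxA /F /G /jacobian !mul_rV_lin1; exact: h.
have GF : G *m F = 1%:M by apply: mulmx1C.
(* Differentials act on row vectors from the right, so [G] comes first. *)
exists (of_real (to_real a *m G)).
rewrite /real_diff -/o of_realK -[a in RHS]to_realK; congr of_real.
by rewrite -mul_rV_lin1 -mulmxA GF mulmx1.
Qed.

End RealDifferential.

(** * Contradiction with the parallelogram law *)

Section NoIsometry.
Context {R : realType}.

(** Only the squeeze of [F] between the two metrics enters, so one argument serves both. *)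
Lemma no_C1_isometry
    (F : forall k, set 'rV[R[i]]_k -> 'rV[R[i]]_k -> 'rV[R[i]]_k -> \bar R)
    m (n_ : 'I_m -> nat) (f : 'rV[R[i]]_(\sum_(j < m) n_ j) -> 'rV[R[i]]_(\sum_(j < m) n_ j)) :
  (forall k (D : set 'rV[R[i]]_k) z xi,
    (caratheodory_metric D z xi <= F k D z xi <= kobayashi_metric D z xi)%E) ->
  (1 < m)%N -> (forall j, (0 < n_ j)%N) ->
  ~ C1_isometry F (unit_ball R (\sum_(j < m) n_ j)) (product_of_balls R n_) f.
Proof.
move=> bounds m1 n0 [[[fP _ _] df [g gf dg]] iso].
have leCF k (D : set 'rV[R[i]]_k) z xi : (caratheodory_metric D z xi <= F k D z xi)%E.
  by case/andP: (bounds k D z xi).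
have leFK k (D : set 'rV[R[i]]_k) z xi : (F k D z xi <= kobayashi_metric D z xi)%E.
  by case/andP: (bounds k D z xi).
set B := unit_ball R _ in fP df gf iso.
set D := product_of_balls R n_ in fP dg iso.
have B0 : B 0 by apply/unit_ballE; rewrite /sqn big1// => j _; rewrite mxE /= expr0n addr0.
have D0 : D (f 0) by exact: fP.
(* Unit vectors are adapted to [f 0], putting it in the image of [along] with real coefficients. *)
have polar j : exists se : R * 'rV[R[i]]_(n_ j), [/\ -1 < se.1 < 1, sqn se.2 = 1 &
    submxrow (f 0) j = se.1%:C *: se.2].
  have [s [e [s0 e1 pE]]] := polar_decomposition (submxrow (f 0) j) (n0 j).
  exists (s, e); split => //=.
  have /unit_ballE := D0 j; rewrite pE sqnZr e1 mulr1; nra.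
have [s [e [s1 e1 pE]]] : exists (s : 'I_m -> R) (e : forall j, 'rV[R[i]]_(n_ j)),
    [/\ forall j, -1 < s j < 1, forall j, sqn (e j) = 1 &
        f 0 = along e (fun j => (s j)%:C)].
  exists (fun j => (projT1 (cid (polar j))).1), (fun j => (projT1 (cid (polar j))).2).
  split=> [j|j|]; [by case: (projT2 (cid (polar j)))..|].
  apply/mxrowP => j; rewrite submxrow_along.
  by case: (projT2 (cid (polar j))).
have L (a : 'rV[R[i]]_(\sum_(j < m) n_ j)) : exists u, real_diff f 0 u = a.
  by apply: (real_diff_surjective a gf); [case: (df 0 B0)|case: (dg _ D0)].
pose a i := along e (fun j => (1 - s j ^+ 2)%:C * (j == i)%:R).
(* The Caratheodory bound on the product travels back to the centre, where linear discs bound [F]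
   above by any [t] exceeding the norm of [u]. *)
have ge1 i u : real_diff f 0 u = a i -> 1 <= sqn u.
  move=> ui; have Fu : (1 <= F _ B 0%R u)%E.
    rewrite -iso// ui pE; apply: le_trans (leCF _ _ _ _).
    exact: caratheodory_product_ge.
  suff : 1 <= Num.sqrt (sqn u).
    by rewrite -{1}sqrtr1 ler_sqrt ?sqn_ge0.
  rewrite leNgt; apply/negP => lt1.
  have [t ut t1] : exists2 t, Num.sqrt (sqn u) < t & t < 1.
    by exists ((Num.sqrt (sqn u) + 1) / 2); lra.
  have := le_trans (le_trans Fu (leFK _ _ _ _)) (kobayashi_ball_le ut).
  by rewrite lee_fin leNgt t1.
(* The opposite chain: linear functionals on the ball below, simultaneous discs in the product
   above. *)
have le1 u sg : (forall j, `|sg j| <= 1) ->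
    real_diff f 0 u = along e (fun j => (1 - s j ^+ 2)%:C * sg j) -> sqn u <= 1.
  move=> sg1 ui; have : ((Num.sqrt (sqn u))%:E <= 1)%E.
    apply: le_trans (caratheodory_ball_ge u) _; apply: le_trans (leCF _ _ _ _) _.
    rewrite -iso// ui pE; apply: le_trans (leFK _ _ _ _) _.
    exact: kobayashi_product_le.
  by rewrite lee_fin -[X in _ <= X]sqrtr1 ler_sqrt.
pose i0 : 'I_m := Ordinal (ltnW m1); pose i1 : 'I_m := Ordinal m1.
have [u0 u0E] := L (a i0); have [u1 u1E] := L (a i1).
have h0 := ge1 _ _ u0E; have h1 := ge1 _ _ u1E.
(* The two blocks are distinct, so the coefficients of the sum and the difference keep modulus at
   most 1. *)
have i01 j : (j == i0) && (j == i1) = false by case: j => -[|[|k]].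
have hp : sqn (u0 + u1) <= 1.
  apply: (le1 _ (fun j => (j == i0)%:R + (j == i1)%:R)) => [j|].
    by have := i01 j; case: (j == i0); case: (j == i1) => //= _;
      rewrite ?addr0 ?add0r ?normr1 ?normr0.
  rewrite real_diffD u0E u1E; apply/mxrowP => j; rewrite submxrowD !submxrow_along.
  by rewrite -scalerDl mulrDr.
have hm : sqn (u0 - u1) <= 1.
  apply: (le1 _ (fun j => (j == i0)%:R - (j == i1)%:R)) => [j|].
    by have := i01 j; case: (j == i0); case: (j == i1) => //= _;
      rewrite ?subr0 ?sub0r ?normrN ?normr1 ?normr0.
  rewrite real_diffB u0E u1E; apply/mxrowP => j; rewrite submxrowB !submxrow_along.
  by rewrite -scalerBl mulrBr.
(* The left side is at most 2, the right side at least 4. *)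
have := sqn_parallelogram u0 u1; lra.
Qed.

End NoIsometry.

Local Close Scope ring_scope.
Local Open Scope nat_scope.

Theorem theorem1p2 (R : realType) (m n : nat) (n_ : 'I_m -> nat)
  (hm : 2 <= m) (hmn : m <= n)
  (hn_ : forall j : 'I_m, 1 <= n_ j)
  (hn : n = \sum_(j < m) n_ j) :
  ~ (exists f : 'rV[complex R]_n -> 'rV[complex R]_(\sum_(j < m) n_ j),
       C1_kobayashi_isometry (unit_ball R n) (product_of_balls R n_) f) /\
  ~ (exists f : 'rV[complex R]_n -> 'rV[complex R]_(\sum_(j < m) n_ j),
       C1_caratheodory_isometry (unit_ball R n) (product_of_balls R n_) f).
Proof.
subst n; split=> -[f]; apply: no_C1_isometry => // k D z xi;
  by rewrite lexx caratheodory_le_kobayashi.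
Qed.
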